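(* Let $p\in(1,\infty)\setminus\{2\}$, let $(X,\Sigma,\lambda)$ be a positive measure space, and let $f\in L_p(X)$. Then the following are equivalent: (a) $f$ is left-symmetric; (b) $f$ is right-symmetric; (c) exactly one of the following conditions holds: (1) $f\equiv0$. (2) $\{x\in X:f(x)\neq0\}$ is an atom. (3) There exist atoms $A$ and $B$ such that $\{x\in X:f(x)\ne0\}=A\sqcup B$ and $\lambda(A)|f(x)|^p=\lambda(B)|f(y)|^p$ for almost every $x\in A$ and almost every $y\in B$.
   Context: $\mathbb{K}$ is $\mathbb{R}$ or $\mathbb{C}$; $L_p(X)$ is the usual space of $\mathbb{K}$-valued $p$-integrable functions (modulo a.e. equality) with norm $\|\cdot\|_p$; $f\equiv0$ means $f=0$ almost everywhere. A set $A\in\Sigma$ is an atom if $\lambda(A)>0$ and for every $B\in\Sigma$ with $B\subset A$ and $\lambda(B)>0$ one has $\lambda(A\setminus B)=0$. $A\sqcup B$ denotes a disjoint union. In a normed space $\mathbb{X}$ over $\mathbb{K}$, $x\perp_B y$ (Birkhoff-James orthogonality) means $\|x+\alpha y\|\ge\|x\|$ for all $\alpha\in\mathbb{K}$; $x\in\mathbb{X}$ is left-symmetric (resp. right-symmetric) if $x\perp_B y\Rightarrow y\perp_B x$ (resp. $y\perp_B x\Rightarrow x\perp_B y$) for every $y\in\mathbb{X}$. *)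

(* Defs.v *)
From HB Require Import structures.
From mathcomp Require Import all_boot all_order all_algebra.
From mathcomp Require Import generic_quotient ring_quotient.
From mathcomp Require Import all_classical all_reals all_analysis.
From mathcomp Require Import measurable_realfun.
From mathcomp Require Import complex.

Set Implicit Arguments.
Unset Strict Implicit.
Unset Printing Implicit Defensive.

Import Order.TTheory GRing.Theory Num.Theory.
Import numFieldNormedType.Exports.

Local Open Scope classical_set_scope.
Local Open Scope ring_scope.

Section birkhoff_james.
Context (K : numFieldType) (V : normedModType K).
Implicit Types x y : V.

Definition BJ_orthogonal x y := forall a : K, `|x + a *: y| >= `|x|.

Definition left_symmetric x :=
  forall y, BJ_orthogonal x y -> BJ_orthogonal y x.

Definition right_symmetric x :=
  forall y, BJ_orthogonal y x -> BJ_orthogonal x y.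

End birkhoff_james.

Definition is_atom d (X : measurableType d) (R : realType)
    (mu : {measure set X -> \bar R}) (A : set X) :=
  [/\ measurable A, (0 < mu A)%E &
      forall B, measurable B -> B `<=` A -> (0 < mu B)%E ->
        mu (A `\` B) = 0%E].

Definition exactly_one (P Q S : Prop) :=
  [\/ [/\ P, ~ Q & ~ S], [/\ ~ P, Q & ~ S] | [/\ ~ P, ~ Q & S]].

(* The two choices, real or complex, of the field of scalars. *)
Variant scalar_kind := RealScalars | ComplexScalars.

Section scalars.
Context (R : realType).
Implicit Type k : scalar_kind.

Definition scalar_field k : numFieldType :=
  match k with RealScalars => R | ComplexScalars => R[i] end.

(* The norm of the numFieldType [scalar_field k] takes its values in
   [scalar_field k] itself; [smod] is the modulus as an element of [R] (see
   [normr_smod]). *)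
Definition smod k : scalar_field k -> R :=
  match k with RealScalars => Num.norm | ComplexScalars => @Normc.normc R end.

Definition real_to_scalar k : R -> scalar_field k :=
  match k with
  | RealScalars => id
  | ComplexScalars => fun r => real_complex R r
  end.

(* A complex function is measurable when its real and imaginary parts are;
   this is Borel measurability for the usual topology of [R[i]]. *)
Definition scalar_measurable k d (X : measurableType d) :
    (X -> scalar_field k) -> Prop :=
  match k with
  | RealScalars => fun f => measurable_fun setT (f : X -> R)
  | ComplexScalars => fun f =>
      measurable_fun setT (fun x => complex.Re (f x) : R) /\
      measurable_fun setT (fun x => complex.Im (f x) : R)
  end.

Lemma normr_smod k (z : scalar_field k) : `|z| = real_to_scalar k (smod z).
Proof. by case: k z. Qed.

Lemma smod_ge0 k (z : scalar_field k) : 0 <= smod z.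
Proof.
case: k z => [z|[a b]] /=; first exact: normr_ge0.
exact: sqrtr_ge0.
Qed.

Lemma smodD k (y z : scalar_field k) : smod (y + z) <= smod y + smod z.
Proof. case: k y z => y z; [exact: ler_normD|exact: le_normcD]. Qed.

Lemma smodM k (y z : scalar_field k) : smod (y * z) = smod y * smod z.
Proof. case: k y z => y z; [exact: normrM|exact: Normc.normcM]. Qed.

Lemma smod0 k : smod (0 : scalar_field k) = 0.
Proof. case: k; [exact: normr0|exact: Normc.normc0]. Qed.

Lemma smod0_eq0 k (z : scalar_field k) : smod z = 0 -> z = 0.
Proof. case: k z => z; [exact: normr0_eq0|exact: Normc.eq0_normc]. Qed.

Lemma real_to_scalarD k (x y : R) :
  real_to_scalar k (x + y) = real_to_scalar k x + real_to_scalar k y.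
Proof. by case: k => //=; rewrite rmorphD. Qed.

Lemma real_to_scalarM k (x y : R) :
  real_to_scalar k (x * y) = real_to_scalar k x * real_to_scalar k y.
Proof. by case: k => //=; rewrite rmorphM. Qed.

Lemma ler_real_to_scalar k (x y : R) :
  (real_to_scalar k x <= real_to_scalar k y) = (x <= y).
Proof. by case: k => //=; rewrite lecR. Qed.

Lemma real_to_scalar_inj k : injective (real_to_scalar k).
Proof. by case: k => [x y|x y []]. Qed.

Section measurability.
Context d (X : measurableType d).

Lemma scalar_measurable_cst k (c : scalar_field k) :
  scalar_measurable (fun _ : X => c).
Proof. by case: k c => c /=; [|split]; exact: measurable_cst. Qed.

Lemma scalar_measurableD k (f g : X -> scalar_field k) :
  scalar_measurable f -> scalar_measurable g ->
  scalar_measurable (fun x => f x + g x).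
Proof.
case: k f g => f g /=; first exact: measurable_funD.
move=> [mRf mIf] [mRg mIg]; split.
- under eq_fun do rewrite raddfD/=; exact: measurable_funD.
- under eq_fun do rewrite raddfD/=; exact: measurable_funD.
Qed.

Lemma scalar_measurableM k (f g : X -> scalar_field k) :
  scalar_measurable f -> scalar_measurable g ->
  scalar_measurable (fun x => f x * g x).
Proof.
case: k f g => f g /=; first exact: measurable_funM.
move=> [mRf mIf] [mRg mIg]; split.
- rewrite (_ : (fun x => _) = (fun x => complex.Re (f x) * complex.Re (g x)
      - complex.Im (f x) * complex.Im (g x))); last first.
    by apply/funext => x; case: (f x) (g x) => [? ?] [? ?].
  by apply: measurable_funB; exact: measurable_funM.
- rewrite (_ : (fun x => _) = (fun x => complex.Re (f x) * complex.Im (g x)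
      + complex.Im (f x) * complex.Re (g x))); last first.
    by apply/funext => x; case: (f x) (g x) => [? ?] [? ?].
  by apply: measurable_funD; exact: measurable_funM.
Qed.

Lemma measurable_smod k (f : X -> scalar_field k) :
  scalar_measurable f -> measurable_fun setT (fun x => smod (f x)).
Proof.
case: k f => f /=; first by move=> mf; exact: measurableT_comp.
move=> [mRf mIf].
rewrite (_ : (fun x => _) = (fun x => Num.sqrt (complex.Re (f x) ^+ 2
    + complex.Im (f x) ^+ 2))); last first.
  by apply/funext => x; case: (f x) => [? ?].
apply: (@measurableT_comp _ _ _ _ _ _ (@Num.sqrt R)).
  by apply: continuous_measurable_fun; exact: sqrt_continuous.
by apply: measurable_funD; exact: measurable_funX.
Qed.

End measurability.
End scalars.

Section Lp.
Context (R : realType) (k : scalar_kind) d (X : measurableType d).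
Context (mu : {measure set X -> \bar R}) (p : R) (p1 : 1 <= p).
Local Notation K := (scalar_field R k).

Definition Lp_eseminorm (f : X -> K) : \bar R :=
  'N[mu]_p%:E[EFin \o (fun x => smod (f x))].

(* The unused argument [1 <= p] lets the closure properties, which need it,
   be attached to the predicate. *)
Definition Lp_integrable & 1 <= p : {pred X -> K^o} :=
  fun f => `[< scalar_measurable f /\ (Lp_eseminorm f < +oo)%E >].

Let p_gt0 : 0 < p. Proof. exact: lt_le_trans ltr01 p1. Qed.

Lemma Lp_eseminorm_ge0 f : (0 <= Lp_eseminorm f)%E.
Proof. exact: Lnorm_ge0. Qed.

Lemma Lp_eseminormE f :
  Lp_eseminorm f = ((\int[mu]_x (smod (f x) `^ p)%:E) `^ p^-1)%E.
Proof.
rewrite /Lp_eseminorm unlock; congr (_ `^ _)%E.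
by apply: eq_integral => x _ /=; rewrite ger0_norm ?smod_ge0.
Qed.

Let measurable_smodp (f : X -> K) : scalar_measurable f ->
  measurable_fun setT (fun x => (smod (f x) `^ p)%:E).
Proof.
move=> mf; apply/measurable_EFinP.
apply: (@measurableT_comp _ _ _ _ _ _ (@powR R ^~ p)) => //.
exact: measurable_smod.
Qed.

Lemma Lp_eseminormD f g : scalar_measurable f -> scalar_measurable g ->
  (Lp_eseminorm (fun x => f x + g x)%R <= Lp_eseminorm f + Lp_eseminorm g)%E.
Proof.
move=> mf mg.
have mF := measurable_smod mf; have mG := measurable_smod mg.
apply: le_trans (minkowski_EFin mu mF mG p1).
rewrite [leLHS]Lp_eseminormE unlock.
apply: gt0_ler_poweR.
- by rewrite invr_ge0 ltW.
- by rewrite in_itv/= leey andbT integral_ge0// => x _; rewrite lee_fin powR_ge0.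
- by rewrite in_itv/= leey andbT integral_ge0// => x _; rewrite poweR_ge0.
apply: ge0_le_integral => //.
- by move=> x _; rewrite lee_fin powR_ge0.
- exact/measurable_smodp/scalar_measurableD.
- under eq_fun do rewrite /= .
  apply/measurable_EFinP.
  apply: (@measurableT_comp _ _ _ _ _ _ (@powR R ^~ p)) => //.
  by apply: measurableT_comp => //; exact: measurable_funD.
- move=> x _; rewrite lee_fin ge0_ler_powR ?nnegrE ?smod_ge0//.
  + exact: ltW.
  + by rewrite ger0_norm ?addr_ge0 ?smod_ge0// smodD.
Qed.

Lemma Lp_eseminormZ (a : K) f : scalar_measurable f ->
  Lp_eseminorm (fun x => a * f x)%R = ((smod a)%:E * Lp_eseminorm f)%E.
Proof.
move=> mf; rewrite !Lp_eseminormE.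
under eq_integral do rewrite smodM powRM ?smod_ge0// EFinM.
rewrite ge0_integralZl//; last 3 first.
- exact: measurable_smodp.
- by move=> x _; rewrite lee_fin powR_ge0.
- by rewrite lee_fin powR_ge0.
rewrite poweRM ?lee_fin ?powR_ge0//; last first.
  by apply: integral_ge0 => x _; rewrite lee_fin powR_ge0.
by rewrite poweR_EFin -powRrM mulfV ?gt_eqF// powRr1// smod_ge0.
Qed.

Lemma Lp_eseminorm_ae f g : scalar_measurable f -> scalar_measurable g ->
  {ae mu, forall x, f x = g x} -> Lp_eseminorm f = Lp_eseminorm g.
Proof.
move=> mf mg fg; rewrite !Lp_eseminormE; congr (_ `^ _)%E.
apply: ge0_ae_eq_integral => //.
- exact: measurable_smodp.
- exact: measurable_smodp.
- by move=> x _; rewrite lee_fin powR_ge0.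
- by move=> x _; rewrite lee_fin powR_ge0.
- by apply: filterS fg => x ->.
Qed.

Lemma Lp_eseminorm_eq0 f : scalar_measurable f -> Lp_eseminorm f = 0%E ->
  {ae mu, forall x, f x = 0}.
Proof.
move=> mf /Lnorm_eq0_eq0 f0.
have {}f0 : (EFin \o (fun x => smod (f x)) = \0 %[ae mu])%E.
  by apply: f0; rewrite ?lte_fin//; exact/measurable_EFinP/measurable_smod.
by apply: filterS f0 => x /= /(_ I) [] /smod0_eq0.
Qed.

Lemma Lp_integrable_submod_closed : submod_closed (Lp_integrable p1).
Proof.
split.
  apply/asboolP; split; first exact: (scalar_measurable_cst X (0 : K)).
  rewrite Lp_eseminormE; under eq_integral do rewrite smod0 powR0 ?gt_eqF//.
  by rewrite integral0 poweR0r ?ltry// invr_neq0// gt_eqF.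
move=> a f g /asboolP[mf Nf] /asboolP[mg Ng]; apply/asboolP.
have maf : scalar_measurable (fun x => a * f x).
  exact: scalar_measurableM (scalar_measurable_cst X a) mf.
split; first exact: scalar_measurableD maf mg.
apply: (le_lt_trans (Lp_eseminormD maf mg)); apply: lte_add_pinfty => //.
rewrite Lp_eseminormZ//; apply: lte_mul_pinfty => //.
by rewrite lee_fin smod_ge0.
Qed.

HB.instance Definition _ := GRing.isSubmodClosed.Build _ _ (Lp_integrable p1)
  Lp_integrable_submod_closed.

Record Lp_fun := MkLp_fun {
  Lp_fun_val :> X -> K^o ;
  Lp_fun_valP : Lp_fun_val \in Lp_integrable p1 }.

HB.instance Definition _ := [isSub for Lp_fun_val].
HB.instance Definition _ := [Choice of Lp_fun by <:].
HB.instance Definition _ := [SubChoice_isSubLmodule of Lp_fun by <:].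

Lemma Lp_fun_measurable (f : Lp_fun) : scalar_measurable (f : X -> K).
Proof. by case: f => f /= /asboolP[]. Qed.

Lemma Lp_fun_finite (f : Lp_fun) : (Lp_eseminorm f < +oo)%E.
Proof. by case: f => f /= /asboolP[]. Qed.

Definition Lp_null : {pred Lp_fun} :=
  fun f => `[< {ae mu, forall x, f x = 0} >].

Lemma Lp_null_zmod_closed : zmod_closed Lp_null.
Proof.
split; first by apply/asboolP; exact: nearW.
move=> f g /asboolP f0 /asboolP g0; apply/asboolP.
apply: filterS2 f0 g0 => x fx0 gx0.
by rewrite -[LHS]/(f x - g x) fx0 gx0 subr0.
Qed.

HB.instance Definition _ := GRing.isZmodClosed.Build _ Lp_null
  Lp_null_zmod_closed.

(* Lp-functions modulo almost everywhere equality (see [Lp_classP]). *)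
Definition Lp : Type := Quotient.quot Lp_null.

HB.instance Definition _ := Choice.on Lp.
HB.instance Definition _ := GRing.Zmodule.on Lp.

Definition Lp_class (f : Lp_fun) : Lp := (\pi_(Quotient.quot Lp_null) f)%qT.

Definition Lp_repr (F : Lp) : Lp_fun := repr (F : Quotient.quot Lp_null).

Lemma Lp_reprK : cancel Lp_repr Lp_class.
Proof. by move=> F; exact: reprK. Qed.

Lemma Lp_classP (f g : Lp_fun) :
  Lp_class f = Lp_class g <-> {ae mu, forall x, f x = g x}.
Proof.
have fgE : (Lp_class f == Lp_class g) = (f - g \in Lp_null).
  by rewrite Quotient.idealrBE.
split=> [/eqP|fg].
  rewrite fgE => /asboolP; apply: filterS => x fgx0.
  by apply/eqP; rewrite -subr_eq0; apply/eqP.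
apply/eqP; rewrite fgE; apply/asboolP; apply: filterS fg => x fgx.
by rewrite -[LHS]/(f x - g x) fgx subrr.
Qed.

Lemma Lp_classD (f g : Lp_fun) :
  Lp_class (f + g) = Lp_class f + Lp_class g.
Proof. by rewrite /Lp_class; exact: (raddfD (\pi_(Quotient.quot Lp_null)%qT)). Qed.

Definition Lp_scale (a : K) (F : Lp) : Lp := Lp_class (a *: Lp_repr F).

Lemma Lp_scale_class a (f : Lp_fun) :
  Lp_scale a (Lp_class f) = Lp_class (a *: f).
Proof.
apply/Lp_classP; have /Lp_classP := Lp_reprK (Lp_class f).
by apply: filterS => x e; congr (a * _).
Qed.

Let Lp_scaleA a b F : Lp_scale a (Lp_scale b F) = Lp_scale (a * b) F.
Proof. by rewrite -[F]Lp_reprK !Lp_scale_class scalerA. Qed.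

Let Lp_scale1 : left_id 1 Lp_scale.
Proof. by move=> F; rewrite -[F]Lp_reprK Lp_scale_class scale1r. Qed.

Let Lp_scaleDr : right_distributive Lp_scale +%R.
Proof.
move=> a F G; rewrite -[F]Lp_reprK -[G]Lp_reprK -Lp_classD !Lp_scale_class.
by rewrite scalerDr Lp_classD.
Qed.

Let Lp_scaleDl F : {morph Lp_scale^~ F : a b / a + b}.
Proof.
move=> a b; rewrite -[F]Lp_reprK !Lp_scale_class.
by rewrite scalerDl Lp_classD.
Qed.

HB.instance Definition _ := GRing.Zmodule_isLmodule.Build K Lp
  Lp_scaleA Lp_scale1 Lp_scaleDr Lp_scaleDl.

(* The norm of a [normedModType K] is [K]-valued, hence the embedding of the
   real number [fine _] into [K]. *)
Definition Lp_norm (F : Lp) : K :=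
  real_to_scalar k (fine (Lp_eseminorm (Lp_repr F))).

Lemma Lp_norm_class (f : Lp_fun) :
  Lp_norm (Lp_class f) = real_to_scalar k (fine (Lp_eseminorm f)).
Proof.
congr (real_to_scalar k (fine _)).
apply: Lp_eseminorm_ae; [exact: Lp_fun_measurable..|].
exact/Lp_classP/Lp_reprK.
Qed.

Let Lp_eseminorm_fin (f : Lp_fun) : Lp_eseminorm f \is a fin_num.
Proof. by rewrite ge0_fin_numE ?Lp_fun_finite// Lp_eseminorm_ge0. Qed.

Let Lp_normD F G : Lp_norm (F + G) <= Lp_norm F + Lp_norm G.
Proof.
rewrite -[F]Lp_reprK -[G]Lp_reprK -Lp_classD !Lp_norm_class.
rewrite -real_to_scalarD ler_real_to_scalar -fineD ?Lp_eseminorm_fin//.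
apply: fine_le; rewrite ?fin_numD ?Lp_eseminorm_fin//.
by apply: Lp_eseminormD; exact: Lp_fun_measurable.
Qed.

Let Lp_normZ a F : Lp_norm (a *: F) = `|a| * Lp_norm F.
Proof.
rewrite -[F]Lp_reprK [a *: _]Lp_scale_class !Lp_norm_class normr_smod.
rewrite -real_to_scalarM; congr real_to_scalar.
rewrite (Lp_eseminormZ a (Lp_fun_measurable _)) fineM//.
Qed.

Let Lp_norm0_eq0 F : Lp_norm F = 0 -> F = 0.
Proof.
have <- : real_to_scalar k 0 = 0 by case: (k).
rewrite -[F]Lp_reprK Lp_norm_class => /real_to_scalar_inj F0.
have -> : 0 = Lp_class 0 by apply/esym; exact: (raddf0 (\pi_(Quotient.quot Lp_null)%qT)).
apply/Lp_classP/(Lp_eseminorm_eq0 (Lp_fun_measurable _)).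
by rewrite -[LHS]fineK// F0.
Qed.

HB.instance Definition _ :=
  Lmodule_isNormed.Build K Lp Lp_normD Lp_normZ Lp_norm0_eq0.

Lemma Lp_normE (f : Lp_fun) :
  `|Lp_class f| = real_to_scalar k (fine (Lp_eseminorm f)).
Proof. exact: Lp_norm_class. Qed.

End Lp.

Arguments Lp_integrable {R} k {d X} mu {p} p1.
Arguments Lp_fun {R} k {d X} mu {p} p1.
Arguments Lp {R} k {d X} mu {p} p1.

(* Main.v *)
Require Import Defs.
From HB Require Import structures.
From mathcomp Require Import all_boot all_order all_algebra.
From mathcomp Require Import all_classical all_reals all_analysis.
From mathcomp Require Import measurable_realfun complex.
From mathcomp Require Import ring lra.

Set Implicit Arguments.
Unset Strict Implicit.
Unset Printing Implicit Defensive.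

Import Order.TTheory GRing.Theory Num.Theory.
Import numFieldNormedType.Exports.

Local Open Scope classical_set_scope.
Local Open Scope ring_scope.

(** Orthogonality in L_p is governed by the duality map [sdual p], which sends
    z to |z|^(p-2) times the conjugate of z: by James' criterion, f is
    Birkhoff-James orthogonal to g exactly when the integral of
    |f|^(p-2) conj(f) g vanishes. Only functions that are multiples u f and v f
    of f on two pieces A and B of the support S of f, and arbitrary off S,
    are ever compared with f here. For them the integrals collapse to finite
    weighted sums: with m(D) the integral of |f|^p over D,
      - f is orthogonal to g iff m(A) u + m(B) v = 0;
      - g is orthogonal to f iff m(A) sdual(u) + m(B) sdual(v) = 0
    ([BJ_orthogonal_two_pieces]). Off S one of the two functions is zero, so
    that part contributes to neither condition. Hence the finite form of James'
    criterion, [weighted_lp_James_criterion], suffices, and no differentiation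
    under an integral occurs.

    Symmetry implies the classification. Let S be split into A and B with
    a = m(A) > 0 and b = m(B) > 0. The choice u = b, v = -a makes f orthogonal
    to g; left-symmetry then gives a b^(p-1) = b a^(p-1), that is a = b since
    p <> 2. For right-symmetry one takes instead u = b^s and v = -a^s, with
    s = 1/(p-1), so that sdual(u) = b and sdual(v) = -a, and gets a b^s = b a^s.
    So any two positive pieces that make up S have equal mass ([balanced]).
    This forbids three pieces C, D, B of positive mass, because
    m(C) = m(D) + m(B) and m(D) = m(C) + m(B) would give m(B) = 0. Therefore S
    is null, an atom, or the union of two atoms of equal mass
    ([balanced_classification]).

    Conversely, a measurable function is a.e. constant on an atom
    ([measurable_ae_cst_on_atom]), so if S is an atom or the union of two atoms,
    every g has the two-piece form above. The two conditions are then equivalent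
    because [sdual p] is odd and injective: with m(A) = m(B) > 0 both say
    v = -u, and with m(B) = 0 < m(A) both say u = 0
    ([symmetric_two_pieces]). The mass of an atom A on which f = c a.e. is
    lambda(A) |c|^p, which turns equality of masses into the a.e. condition of
    the theorem ([mass_eq_ae]). *)

(** * Conjugation, real part and modulus of scalars *)

Section scalars.
Context {R : realType} {k : scalar_kind}.
Local Notation K := (scalar_field R k).
Local Notation "r %:K" := (real_to_scalar k r) (at level 2, format "r %:K").
Implicit Types (r s t : R) (z w v : K).

Definition sconj : K -> K :=
  match k with RealScalars => id | ComplexScalars => @conjc R end.

Definition sre : K -> R :=
  match k with RealScalars => id | ComplexScalars => @complex.Re R end.

Lemma real_to_scalar0 : (0 : R)%:K = 0.
Proof. by case: k. Qed.

Lemma real_to_scalar1 : (1 : R)%:K = 1.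
Proof. by case: k. Qed.

Lemma real_to_scalarN r : (- r)%:K = - r%:K.
Proof. by rewrite /real_to_scalar; case: k => //=; rewrite rmorphN. Qed.

Lemma smod_real r : smod r%:K = `|r|.
Proof.
rewrite /real_to_scalar /smod; case: k => //=.
by rewrite expr0n addr0 sqrtr_sqr.
Qed.

Lemma smod1 : smod (1 : K) = 1.
Proof. by rewrite -real_to_scalar1 smod_real normr1. Qed.

Lemma smod_eq0 z : (smod z == 0) = (z == 0).
Proof. by apply/eqP/eqP => [/smod0_eq0|->]; rewrite ?smod0. Qed.

Lemma smod_gt0 z : (0 < smod z) = (z != 0).
Proof. by rewrite lt_neqAle smod_ge0 andbT eq_sym smod_eq0. Qed.

Lemma smodN z : smod (- z) = smod z.
Proof.
rewrite -mulN1r smodM -real_to_scalar1 -real_to_scalarN smod_real.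
by rewrite normrN1 mul1r.
Qed.

Lemma sconj0 : sconj 0 = 0.
Proof. by rewrite /sconj; case: k => //=; rewrite /conjc /= oppr0. Qed.

Lemma sconj_real r : sconj r%:K = r%:K.
Proof. by rewrite /sconj/real_to_scalar; case: k => //=; rewrite oppr0. Qed.

Lemma sconj1 : sconj 1 = 1.
Proof. by rewrite -real_to_scalar1 sconj_real. Qed.

Lemma sconjD z w : sconj (z + w) = sconj z + sconj w.
Proof. by move: z w; rewrite /sconj; case: k => // z w; exact: rmorphD. Qed.

Lemma sconjM z w : sconj (z * w) = sconj z * sconj w.
Proof. by move: z w; rewrite /sconj; case: k => // z w; exact: rmorphM. Qed.

Lemma sconjN z : sconj (- z) = - sconj z.
Proof. by move: z; rewrite /sconj; case: k => // z; exact: rmorphN. Qed.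

Lemma sconjK : involutive sconj.
Proof. by rewrite /sconj; case: k => // z; exact: conjcK. Qed.

Lemma smod_conj z : smod (sconj z) = smod z.
Proof.
by move: z; rewrite /sconj/smod; case: k => // -[a b] /=; rewrite sqrrN.
Qed.

Lemma sconj_mul z : sconj z * z = (smod z ^+ 2)%:K.
Proof.
move: z; rewrite /sconj/smod/real_to_scalar; case: k => [z|[a b]] /=.
  by rewrite real_normK ?num_real// expr2.
rewrite sqr_sqrtr ?addr_ge0 ?sqr_ge0//.
by apply/eqP; rewrite eq_complex /=; apply/andP; split; apply/eqP; ring.
Qed.

Lemma sre0 : sre 0 = 0.
Proof. by rewrite /sre; case: k. Qed.

Lemma sreD z w : sre (z + w) = sre z + sre w.
Proof. by move: z w; rewrite /sre; case: k => // z w; exact: raddfD. Qed.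

Lemma sre_real r : sre r%:K = r.
Proof. by rewrite /sre/real_to_scalar; case: k. Qed.

Lemma sreM r z : sre (r%:K * z) = r * sre z.
Proof.
move: z; rewrite /sre/real_to_scalar; case: k => // -[a b] /=.
by rewrite mul0r subr0.
Qed.

Lemma sre_sum (I : Type) (s : seq I) (P : pred I) (F : I -> K) :
  sre (\sum_(i <- s | P i) F i) = \sum_(i <- s | P i) sre (F i).
Proof. exact: (big_morph _ sreD sre0). Qed.

Lemma sre_le_smod z : sre z <= smod z.
Proof.
move: z; rewrite /sre/smod; case: k => [z|[a b]] /=; first exact: ler_norm.
apply: (le_trans (ler_norm a)); rewrite -sqrtr_sqr ler_wsqrtr//.
by rewrite lerDl sqr_ge0.
Qed.

End scalars.

Notation "r %:K" := (real_to_scalar _ r) (at level 2, format "r %:K").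

(** * Two facts about real powers *)

Section powR_inequalities.
Context {R : realType}.
Implicit Types p s x y : R.

(** The graph of the p-th power lies above its tangent at x; this is Young's
    inequality for y and x^(p-1), whose exponents are p and p/(p-1). *)
Lemma powR_supporting_line p x y : 1 < p -> 0 <= x -> 0 <= y ->
  p * (x `^ (p - 1) * y) <= y `^ p + (p - 1) * x `^ p.
Proof.
move=> p1 x0 y0.
have p0 : 0 < p by lra.
have q0 : 0 < p - 1 by lra.
have q_gt0 : 0 < p / (p - 1) by rewrite divr_gt0.
have pq1 : p^-1 + (p / (p - 1))^-1 = 1 by field; rewrite !gt_eqF.
have := conjugate_powR y0 (powR_ge0 x (p - 1)) p0 q_gt0 pq1.
have -> : x `^ (p - 1) `^ (p / (p - 1)) = x `^ p.
  by rewrite -powRrM; congr (_ `^ _); field; rewrite gt_eqF.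
rewrite -(ler_pM2l p0).
have -> : p * (y `^ p / p + x `^ p / (p / (p - 1))) = y `^ p + (p - 1) * x `^ p.
  by field; rewrite !gt_eqF.
by rewrite [y * _]mulrC.
Qed.

(** Dividing by x y turns the hypothesis into an equality of (s-1)-th powers,
    which are injective; in logarithms, (1 - s)(ln x - ln y) = 0. It is the only
    place where the exclusion of p = 2 enters, through s = p-1 and
    s = 1/(p-1). *)
Lemma mul_powR_inj s x y : s != 1 -> 0 < x -> 0 < y ->
  x * y `^ s = y * x `^ s -> x = y.
Proof.
move=> s1 x0 y0 /(congr1 (@ln R)).
rewrite !lnM ?posrE ?powR_gt0// !ln_powR => e.
apply: ln_inj; rewrite ?posrE//; apply/eqP; rewrite -subr_eq0.
have /eqP : (1 - s) * (ln x - ln y) = 0 by lra.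
by rewrite mulf_eq0 [1 - s == 0]subr_eq0 [1 == s]eq_sym (negbTE s1).
Qed.

End powR_inequalities.
(** * The duality map of the scalar field *)

Section duality_map.
Context {R : realType} {k : scalar_kind}.
Local Notation K := (scalar_field R k).
Implicit Types (p r s t : R) (z w v : K).

(** The factor [sconj z] gives [sdual p 0 = 0] for every p, whatever value the
    power takes at 0. *)
Definition sdual p z : K := (smod z `^ (p - 2))%:K * sconj z.

Lemma sdual0 p : sdual p 0 = 0.
Proof. by rewrite /sdual sconj0 mulr0. Qed.

Lemma sdual1 p : sdual p 1 = 1.
Proof. by rewrite /sdual smod1 powR1 sconj1 mulr1 real_to_scalar1. Qed.

Lemma sdualN p z : sdual p (- z) = - sdual p z.
Proof. by rewrite /sdual smodN sconjN mulrN. Qed.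

Lemma sdual_real p r : 0 < r -> sdual p r%:K = (r `^ (p - 1))%:K.
Proof.
move=> r0; rewrite /sdual sconj_real smod_real gtr0_norm// -real_to_scalarM.
congr (real_to_scalar _ _); rewrite mulrC -[X in X * _]powRr1 ?ltW// -powRD.
  by congr (_ `^ _); ring.
by rewrite (gt_eqF r0) implybT.
Qed.

Lemma sdualM p z w : sdual p (z * w) = sdual p z * sdual p w.
Proof.
rewrite /sdual smodM sconjM powRM ?smod_ge0// real_to_scalarM.
by rewrite mulrACA.
Qed.

Lemma smod_sdual p z : 1 < p -> smod (sdual p z) = smod z `^ (p - 1).
Proof.
move=> p1; have [->|z0] := eqVneq z 0.
  by rewrite sdual0 smod0 powR0// gt_eqF// subr_gt0.
rewrite smodM smod_real smod_conj ger0_norm ?powR_ge0//.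
rewrite mulrC -[X in X * _]powRr1 ?smod_ge0// -powRD.
  by congr (_ `^ _); ring.
by rewrite smod_eq0 (negbTE z0) implybT.
Qed.

Lemma sdual_mul p z : 1 < p -> sdual p z * z = (smod z `^ p)%:K.
Proof.
move=> p1; have [->|z0] := eqVneq z 0.
  by rewrite mulr0 smod0 powR0 ?real_to_scalar0// gt_eqF//; lra.
rewrite /sdual -mulrA sconj_mul -real_to_scalarM; congr (real_to_scalar _ _).
rewrite -powR_mulrn ?smod_ge0// -powRD.
  by congr (_ `^ _); ring.
by rewrite smod_eq0 (negbTE z0) implybT.
Qed.

Lemma sdual_inj p : 1 < p -> injective (sdual p).
Proof.
move=> p1 z w zw.
have : smod z `^ (p - 1) = smod w `^ (p - 1) by rewrite -!smod_sdual// zw.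
move=> /(congr1 (fun x => x `^ (p - 1)^-1)).
rewrite -!powRrM mulfV ?gt_eqF ?subr_gt0// !powRr1 ?smod_ge0// => szw.
have [z0|z0] := eqVneq z 0.
  by apply/esym; rewrite z0; apply: smod0_eq0; rewrite -szw z0 smod0.
have : sconj z = sconj w.
  move: zw; rewrite /sdual szw; apply: mulfI.
  by rewrite -smod_eq0 smod_real normr_eq0 gt_eqF// powR_gt0// -szw smod_gt0.
by move=> /(congr1 sconj); rewrite !sconjK.
Qed.

(** [p * sdual p z] is the gradient of the convex function |.|^p at z. The
    inequality follows from the supporting line at |z|, since the real part of
    [sdual p z * (z + v)] is at most |z|^(p-1) |z + v|. *)
Lemma sdual_supporting p z v : 1 < p ->
  smod z `^ p + p * sre (sdual p z * v) <= smod (z + v) `^ p.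
Proof.
move=> p1; have p0 : 0 < p by lra.
have := sre_le_smod (sdual p z * (z + v)).
rewrite smodM smod_sdual// mulrDr sreD sdual_mul// sre_real.
rewrite -(ler_pM2l p0) => le.
have := powR_supporting_line p1 (smod_ge0 z) (smod_ge0 (z + v)).
lra.
Qed.

(** Continuity of the gradient along a ray. At z = 0 the power |.|^(p-2) may blow
    up, but there homogeneity makes the expression t^(p-1) |v|^p. *)
Lemma sre_sdual_cvg p z v : 1 < p ->
  sre (sdual p (z + t%:K * v) * v) @[t --> 0^'+] --> sre (sdual p z * v).
Proof.
move=> p1; have [->|z0] := eqVneq z 0.
  rewrite sdual0 mul0r sre0.
  have : (t `^ (p - 1) * smod v `^ p) @[t --> 0^'+] --> 0 * smod v `^ p.
    by apply: cvgMl; apply: powR_cvg0; rewrite subr_gt0.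
  rewrite mul0r; apply: cvg_trans; apply: near_eq_cvg; near=> t.
  rewrite add0r sdualM -mulrA sdual_mul// sdual_real//.
  by rewrite -real_to_scalarM sre_real.
have cvg_id : (t : R) @[t --> 0^'+] --> 0 by exact: cvg_at_right_filter.
have cvg_smod : smod (z + t%:K * v) @[t --> 0^'+] --> smod z.
  have : smod z + t * smod v @[t --> 0^'+] --> smod z + 0 * smod v.
    by apply: cvgD; [exact: cvg_cst|exact: cvgMl].
  have : smod z - t * smod v @[t --> 0^'+] --> smod z - 0 * smod v.
    by apply: cvgB; [exact: cvg_cst|exact: cvgMl].
  rewrite mul0r subr0 addr0; apply: squeeze_cvgr; near=> t.
  have t0 : 0 < t by [].
  have stv : smod (t%:K * v) = t * smod v by rewrite smodM smod_real gtr0_norm.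
  apply/andP; split; last by rewrite (le_trans (smodD _ _))// stv.
  have := smodD (z + t%:K * v) (- (t%:K * v)).
  by rewrite addrK smodN stv lerBlDr.
have z_gt0 : 0 < smod z by rewrite smod_gt0.
have cvg_pow :
    smod (z + t%:K * v) `^ (p - 2) @[t --> 0^'+] --> smod z `^ (p - 2).
  have cont : {for smod z, continuous (fun x : R => x `^ (p - 2))}.
    apply: differentiable_continuous; apply/derivable1_diffP.
    by apply: derivable_powR; rewrite in_itv/= z_gt0.
  exact: (continuous_cvg _ cont cvg_smod).
have : smod (z + t%:K * v) `^ (p - 2) * (sre (sconj z * v) + t * smod v ^+ 2)
    @[t --> 0^'+] --> smod z `^ (p - 2) * (sre (sconj z * v) + 0 * smod v ^+ 2).
  by apply: cvgM => //; apply: cvgD; [exact: cvg_cst|exact: cvgMl].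
rewrite mul0r addr0 -sreM mulrA; apply: cvg_trans.
apply: near_eq_cvg; near=> t.
rewrite /sdual sconjD sconjM sconj_real -mulrA sreM mulrDl sreD.
by rewrite -mulrA sconj_mul sreM sre_real.
Unshelve. all: by end_near.
Qed.

End duality_map.

(** * James' criterion for finite weighted sums *)

Section James.
Context {R : realType} {k : scalar_kind}.
Local Notation K := (scalar_field R k).

(** Sufficiency is the gradient inequality summed over the indices. For necessity,
    let v_i = a w_i; the gradient inequality at z + t v, read backwards towards
    z, bounds the nonnegative increment of the sum by t p times the sum of
    m_i Re (sdual (z_i + t v_i) v_i). Dividing by t > 0 and letting t tend to 0
    gives Re (a T) >= 0 for every scalar a, where T is the sum in the statement,
    and a = - conj T leaves only T = 0. *)
Lemma weighted_lp_James_criterion (n : nat) (p : R) (m : 'I_n -> R)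
    (z w : 'I_n -> K) :
  1 < p -> (forall i, 0 <= m i) ->
  (forall a : K, \sum_(i < n) m i * smod (z i) `^ p <=
                 \sum_(i < n) m i * smod (z i + a * w i) `^ p) <->
  \sum_(i < n) (m i)%:K * sdual p (z i) * w i = 0.
Proof.
move=> p1 m0; have p0 : 0 < p by lra.
set T := \sum_(i < n) _ * _ * _.
have sreT a : sre (a * T) = \sum_(i < n) m i * sre (sdual p (z i) * (a * w i)).
  rewrite mulr_sumr sre_sum; apply: eq_bigr => i _.
  by rewrite -sreM; congr sre; ring.
split=> [min|T0 a]; last first.
  have -> : \sum_(i < n) m i * smod (z i) `^ p =
      \sum_(i < n)
        m i * (smod (z i) `^ p + p * sre (sdual p (z i) * (a * w i))).
    under [RHS]eq_bigr do rewrite mulrDr mulrCA.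
    by rewrite big_split/= -mulr_sumr -sreT T0 mulr0 sre0 mulr0 addr0.
  by apply: ler_sum => i _; rewrite ler_wpM2l// sdual_supporting.
have sre_ge0 a : 0 <= sre (a * T).
  have : \sum_(i < n) m i * sre (sdual p (z i + t%:K * (a * w i)) * (a * w i))
      @[t --> 0^'+] --> sre (a * T).
    rewrite sreT; apply: cvg_big => [|i _]; first exact: add_continuous.
    by apply: cvgMr; exact: sre_sdual_cvg.
  move=> /cvgr_to_ge; apply; near=> t.
  have t0 : 0 < t by [].
  rewrite -(pmulr_rge0 _ (mulr_gt0 p0 t0)) mulr_sumr.
  have : 0 <= \sum_(i < n) (m i * smod (z i + t%:K * (a * w i)) `^ p -
                            m i * smod (z i) `^ p).
    by rewrite sumrB subr_ge0; under [leRHS]eq_bigr do rewrite mulrA.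
  move=> /le_trans; apply; apply: ler_sum => i _.
  rewrite -mulrBr [leRHS]mulrCA ler_wpM2l//.
  have := sdual_supporting (z i + t%:K * (a * w i)) (- (t%:K * (a * w i))) p1.
  set v := a * w i; set u := sdual p _.
  have -> : u * - (t%:K * v) = (- t)%:K * (u * v).
    by rewrite real_to_scalarN; ring.
  by rewrite addrK sreM => ?; nra.
have := sre_ge0 (- sconj T); rewrite mulNr sconj_mul -real_to_scalarN sre_real.
rewrite oppr_ge0 => T0; apply/eqP; rewrite -smod_eq0 -sqrf_eq0.
by rewrite eq_le T0 sqr_ge0.
Unshelve. all: by end_near.
Qed.

End James.
(** * Measurable functions on atoms *)

Section atoms.
Context {R : realType} {d} {X : measurableType d}.
Context (mu : {measure set X -> \bar R}).

Lemma ae_notin (N : set X) : measurable N -> mu N = 0%E ->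
  {ae mu, forall x, ~ N x}.
Proof. by move=> mN N0; exists N; split=> // x /= /contrapT. Qed.

Lemma ae_notin_measure0 (N : set X) : measurable N ->
  {ae mu, forall x, ~ N x} -> mu N = 0%E.
Proof.
move=> mN [M [mM M0 sub]]; apply/eqP; rewrite -measure_le0 -M0.
by rewrite le_measure ?inE// => x Nx; apply: sub => /=; apply.
Qed.

Lemma atom_not_null (A : set X) : is_atom mu A -> ~ {ae mu, forall x, ~ A x}.
Proof.
by move=> [mA A0 _] /(ae_notin_measure0 mA) A00; rewrite A00 ltxx in A0.
Qed.

Lemma atom_ae_dichotomy (A B : set X) : is_atom mu A -> measurable B ->
  {ae mu, forall x, A x -> B x} \/ {ae mu, forall x, A x -> ~ B x}.
Proof.
move=> [mA A0 Aatom] mB; have mAB : measurable (A `&` B) by exact: measurableI.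
have [AB0|] := eqVneq (mu (A `&` B)) 0%E.
  right; apply: filterS (ae_notin mAB AB0) => x /= nAB Ax Bx.
  exact: nAB.
rewrite -measure_gt0 => AB0; left.
have := Aatom _ mAB (@subIsetl _ _ _) AB0.
have mAAB : measurable (A `\` (A `&` B)) by exact: measurableD.
move=> /(ae_notin mAAB); apply: filterS => x /= nAB Ax.
by apply: contrapT => nB; apply: nAB; split=> // -[].
Qed.

(** By the dichotomy each level r satisfies either r <= h a.e. on A or h < r a.e.
    on A. The constant is the supremum of the levels of the first kind, a set
    that is neither empty nor unbounded because A is not null and is covered by
    the sets where |h| < n. *)
Lemma measurable_ae_cst_on_atom (A : set X) (h : X -> R) : is_atom mu A ->
  measurable_fun setT h -> exists c, {ae mu, forall x, A x -> h x = c}.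
Proof.
move=> Aatom mh.
pose low r := {ae mu, forall x, A x -> r <= h x}.
have notlow r : ~ low r -> {ae mu, forall x, A x -> h x < r}.
  move=> nlow; have mr : measurable (h @^-1` `[r, +oo[).
    by rewrite -[X in measurable X]setTI; exact: mh.
  have [lowr|] := atom_ae_dichotomy Aatom mr.
    by exfalso; apply: nlow; apply: filterS lowr => x /= + /[dup] Ax => /(_ Ax);
      rewrite in_itv/= andbT.
  apply: filterS => x /= + Ax => /(_ Ax).
  by rewrite in_itv/= andbT ltNge => /negP.
(* Otherwise h < - n a.e. on A for every n, and A is null. *)
have [N lowN] : exists n : nat, low (- n%:R).
  apply: contrapT => /forallNP nlow; apply: (atom_not_null Aatom).
  have : {ae mu, forall x, forall n : nat, A x -> h x < - n%:R}.
    by apply: ae_foralln => n; exact: notlow.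
  apply: filterS => x hx Ax; have := hx (Num.truncn `|h x|).+1 Ax.
  have := truncnS_gt `|h x|; have := ler_norm (- h x); rewrite normrN.
  by set r : R := _.+1%:R; lra.
have [M nlowM] : exists n : nat, ~ low n%:R.
  apply: contrapT => /forallNP lowall; apply: (atom_not_null Aatom).
  have : {ae mu, forall x, forall n : nat, A x -> n%:R <= h x}.
    by apply: ae_foralln => n; apply: contrapT; exact: lowall.
  apply: filterS => x hx Ax; have := hx (Num.truncn `|h x|).+1 Ax.
  have := truncnS_gt `|h x|; have := ler_norm (h x).
  by set r : R := _.+1%:R; lra.
have lowS : has_sup [set r | low r].
  split; first by exists (- N%:R).
  exists M%:R => r /= lowr; rewrite leNgt; apply/negP => Mr.
  apply: nlowM; apply: filterS lowr => x /= + Ax => /(_ Ax).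
  exact: (le_trans (ltW Mr)).
exists (sup [set r | low r]); set c := sup _.
have : {ae mu, forall x, forall n : nat,
    A x -> c - n.+1%:R^-1 <= h x <= c + n.+1%:R^-1}.
  apply: ae_foralln => n; have n0 : (0 : R) < n.+1%:R^-1 by rewrite invr_gt0.
  move: n0; set r : R := _^-1 => r0.
  have [e lowe ce] := sup_adherent r0 lowS.
  have : ~ low (c + r).
    by move=> /(ub_le_sup lowS.2) /=; rewrite -/c; lra.
  move=> /notlow; apply: filterS2 lowe => x /= le lt Ax.
  by have := le Ax; have := lt Ax; rewrite -/c in ce; lra.
apply: filterS => x /= hx Ax; apply/eqP; rewrite -subr_eq0 -normr_eq0.
rewrite eq_le normr_ge0 andbT; apply/ler_addgt0Pl => e e0; rewrite addr0.
have := hx (Num.truncn e^-1) Ax.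
have : (Num.truncn e^-1).+1%:R^-1 < e.
  by rewrite invf_plt ?posrE// truncnS_gt.
by rewrite ler_norml; set r : R := _^-1; lra.
Qed.

Lemma scalar_measurable_ae_cst_on_atom k (A : set X)
    (h : X -> scalar_field R k) :
  is_atom mu A -> scalar_measurable h ->
  exists c, {ae mu, forall x, A x -> h x = c}.
Proof.
move=> Aatom; case: k h => h; first exact: measurable_ae_cst_on_atom.
move=> [/(measurable_ae_cst_on_atom Aatom)[a ha]].
move=> /(measurable_ae_cst_on_atom Aatom)[b hb].
exists (Complex a b); apply: filterS2 ha hb => x /= ha hb Ax.
by rewrite -(ha Ax) -(hb Ax); case: (h x).
Qed.

End atoms.
(** * Orthogonality in L_p of piecewise proportional functions *)

Section energy.
Context {R : realType} {k : scalar_kind} {d} {X : measurableType d}.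
Context (mu : {measure set X -> \bar R}) {p : R} (p_gt1 : 1 < p).
Local Notation K := (scalar_field R k).
Local Notation Lpf := (Lp_fun k mu (ltW p_gt1)).
Implicit Types (f g : Lpf) (A B D : set X) (h : X -> K).

Let p_gt0 : 0 < p. Proof. exact: lt_trans p_gt1. Qed.

Definition energy D h : \bar R := (\int[mu]_(x in D) (smod (h x) `^ p)%:E)%E.

Definition mass f D : R := fine (energy D f).

Lemma measurable_smod_powR h : scalar_measurable h ->
  measurable_fun setT (fun x => (smod (h x) `^ p)%:E).
Proof.
move=> mh; apply/measurable_EFinP.
apply: (@measurableT_comp _ _ _ _ _ _ (@powR R ^~ p)) => //.
exact: measurable_smod.
Qed.

Lemma energy_ge0 D h : (0 <= energy D h)%E.
Proof. by apply: integral_ge0 => x _; rewrite lee_fin powR_ge0. Qed.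

Lemma Lp_eseminorm_energy h : Lp_eseminorm mu p h = (energy setT h `^ p^-1)%E.
Proof. exact: Lp_eseminormE. Qed.

Lemma Lp_energy_lty f D : measurable D -> (energy D f < +oo)%E.
Proof.
move=> mD; have mf := measurable_smod_powR (Lp_fun_measurable f).
apply: (@le_lt_trans _ _ (energy setT f)).
  by apply: ge0_subset_integral => // x _; rewrite lee_fin powR_ge0.
have := Lp_fun_finite f; rewrite Lp_eseminorm_energy.
by apply: lty_poweRy; rewrite invr_neq0// gt_eqF.
Qed.

Lemma energy_mass f D : measurable D -> energy D f = (mass f D)%:E.
Proof.
by move=> mD; rewrite /mass fineK// ge0_fin_numE ?energy_ge0// Lp_energy_lty.
Qed.

Lemma mass_ge0 f D : 0 <= mass f D.
Proof. by rewrite fine_ge0// energy_ge0. Qed.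

(** Comparing norms amounts to comparing their p-th powers, which, unlike the
    norms, are additive over disjoint sets. *)
Lemma BJ_orthogonal_energy f g :
  BJ_orthogonal (Lp_class f) (Lp_class g) <->
  forall a : K, (energy setT f <= energy setT (fun x => f x + a * g x)%R)%E.
Proof.
rewrite /BJ_orthogonal.
suff normE a : (`|Lp_class f| <= `|Lp_class f + a *: Lp_class g|) =
    (energy setT f <= energy setT (fun x => f x + a * g x)%R)%E.
  by split=> le a; have := le a; rewrite normE.
have -> : Lp_class f + a *: Lp_class g = Lp_class (f + a *: g).
  by rewrite Lp_classD -Lp_scale_class.
have finN (e : Lpf) : Lp_eseminorm mu p e \is a fin_num.
  by rewrite ge0_fin_numE ?Lp_fun_finite// Lp_eseminorm_ge0.
have eN (e : Lpf) : (energy setT e = Lp_eseminorm mu p e `^ p)%E.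
  rewrite Lp_eseminorm_energy -poweRrM ?energy_ge0// mulVf ?gt_eqF//.
  by rewrite poweRe1// energy_ge0.
rewrite !Lp_normE ler_real_to_scalar -lee_fin !fineK//.
apply/idP/idP => le.
  rewrite [leLHS]eN [leRHS](eN (f + a *: g)).
  apply: gt0_ler_poweR; rewrite ?in_itv/= ?leey ?andbT ?Lp_eseminorm_ge0//.
  exact: ltW.
rewrite !Lp_eseminorm_energy; apply: gt0_ler_poweR => //.
- by rewrite invr_ge0 ltW.
- by rewrite in_itv/= leey andbT energy_ge0.
- by rewrite in_itv/= leey andbT energy_ge0.
Qed.

Lemma energy_ae_scale D h f c : measurable D -> scalar_measurable h ->
  {ae mu, forall x, D x -> h x = c * f x} ->
  energy D h = (mass f D * smod c `^ p)%:E.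
Proof.
move=> mD mh hcf; have mf := Lp_fun_measurable f.
have mcf : scalar_measurable (fun x => c * f x).
  exact: scalar_measurableM (scalar_measurable_cst X c) mf.
rewrite mulrC EFinM -energy_mass//.
transitivity (energy D (fun x => c * f x)).
  apply: ge0_ae_eq_integral => //.
  - exact/measurable_funTS/measurable_smod_powR.
  - exact/measurable_funTS/measurable_smod_powR.
  - by move=> x _; rewrite lee_fin powR_ge0.
  - by move=> x _; rewrite lee_fin powR_ge0.
  - by apply: filterS hcf => x /= hx Dx; rewrite hx.
rewrite /energy; under eq_integral do rewrite smodM powRM ?smod_ge0// EFinM.
rewrite ge0_integralZl//.
- exact/measurable_funTS/measurable_smod_powR.
- by move=> x _; rewrite lee_fin powR_ge0.
- by rewrite lee_fin powR_ge0.
Qed.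

Lemma energy_bigsetU (n : nat) (D : 'I_n -> set X) h :
  (forall i, measurable (D i)) -> trivIset setT D ->
  \big[setU/set0]_(i < n) D i = setT -> scalar_measurable h ->
  energy setT h = (\sum_(i < n) energy (D i) h)%E.
Proof.
move=> mD tD DT mh; rewrite /energy -DT ge0_integral_bigsetU//.
- by rewrite index_enum_uniq.
- by move=> i j _ _; exact: tD.
- exact/measurable_funTS/measurable_smod_powR.
- by move=> x _; rewrite lee_fin powR_ge0.
Qed.

(** When f and g are multiples z_i h_i and w_i h_i of a common function on each
    piece D_i, the p-th power of the norm of f + a g is the sum of
    m_i |z_i + a w_i|^p, and the finite criterion applies. The reference function
    may change from piece to piece, so that a piece on which f vanishes and g is
    arbitrary is covered by taking h_i = g, z_i = 0 and w_i = 1. *)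
Lemma BJ_orthogonal_piecewise (n : nat) (D : 'I_n -> set X) (h : 'I_n -> Lpf)
    (z w : 'I_n -> K) f g :
  (forall i, measurable (D i)) -> trivIset setT D ->
  \big[setU/set0]_(i < n) D i = setT ->
  (forall i, {ae mu, forall x, D i x -> f x = z i * h i x}) ->
  (forall i, {ae mu, forall x, D i x -> g x = w i * h i x}) ->
  BJ_orthogonal (Lp_class f) (Lp_class g) <->
  \sum_(i < n) (mass (h i) (D i))%:K * sdual p (z i) * w i = 0.
Proof.
move=> mD tD DT fz gw.
apply: (iff_trans (BJ_orthogonal_energy f g)).
have mD0 i := mass_ge0 (h i) (D i).
apply: (iff_trans _ (weighted_lp_James_criterion z w p_gt1 mD0)).
have E (e : X -> K) (c : 'I_n -> K) : scalar_measurable e ->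
    (forall i, {ae mu, forall x, D i x -> e x = c i * h i x}) ->
    energy setT e = (\sum_(i < n) mass (h i) (D i) * smod (c i) `^ p)%:E.
  move=> me ec; rewrite (energy_bigsetU mD tD DT me) -sumEFin.
  by apply: eq_bigr => i _; exact: energy_ae_scale (mD i) me (ec i).
have mfg a : scalar_measurable (fun x => f x + a * g x).
  apply: scalar_measurableD; first exact: Lp_fun_measurable.
  apply: scalar_measurableM; first exact: scalar_measurable_cst.
  exact: Lp_fun_measurable.
have Efg a := E _ (fun i => z i + a * w i) (mfg a).
have {}Efg a : energy setT (fun x => f x + a * g x) =
    (\sum_(i < n) mass (h i) (D i) * smod (z i + a * w i) `^ p)%:E.
  apply: Efg => i; apply: filterS2 (fz i) (gw i) => x /= ef eg Dx.
  by rewrite ef// eg//; ring.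
have Ef := E _ z (Lp_fun_measurable f) fz.
by split=> le a; have := le a; rewrite Ef Efg lee_fin.
Qed.

(** The third piece, the complement of the support of f, drops out of both sums:
    of the first because [sdual p 0 = 0], of the second because f is 0 there. *)
Lemma BJ_orthogonal_two_pieces f g A B (u v : K) :
  measurable A -> measurable B -> A `&` B = set0 ->
  [set x | f x != 0] = A `|` B ->
  {ae mu, forall x, A x -> g x = u * f x} ->
  {ae mu, forall x, B x -> g x = v * f x} ->
  (BJ_orthogonal (Lp_class f) (Lp_class g) <->
    (mass f A)%:K * u + (mass f B)%:K * v = 0) /\
  (BJ_orthogonal (Lp_class g) (Lp_class f) <->
    (mass f A)%:K * sdual p u + (mass f B)%:K * sdual p v = 0).
Proof.
move=> mA mB AB0 fAB gA gB.
pose D (i : 'I_3) := nth set0 [:: A; B; ~` (A `|` B)] i.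
pose h (i : 'I_3) := nth f [:: f; f; g] i.
pose z (i : 'I_3) : K := nth 0 [:: 1; 1; 0] i.
pose w (i : 'I_3) : K := nth 0 [:: u; v; 1] i.
have mD i : measurable (D i).
  case: i => [[|[|[|]]]]//= ?; rewrite /D/=//.
  by apply: measurableC; exact: measurableU.
have DT : \big[setU/set0]_(i < 3) D i = setT.
  by rewrite !big_ord_recl big_ord0 /D/= setU0 setUA setUv.
have nAB x : A x -> B x -> False.
  by move=> Ax Bx; suff : set0 x by []; rewrite -AB0.
have tD : trivIset setT D.
  move=> i j _ _ [x []]; have := @nAB x.
  case: i => [[|[|[|]]]]//= ?; case: j => [[|[|[|]]]]//= ?; rewrite /D/=;
    by move=> *; apply: val_inj => //=; exfalso; tauto.
have fz i : {ae mu, forall x, D i x -> f x = z i * h i x}.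
  case: i => [[|[|[|]]]]//= i3; apply: nearW => x;
    rewrite /D/z/h/= ?mul1r// mul0r.
  move=> nS; apply/eqP; apply: contrapT => /negP fx0; apply: nS.
  by rewrite -[_ \/ _]/((A `|` B) x) -fAB.
have gw i : {ae mu, forall x, D i x -> g x = w i * h i x}.
  case: i => [[|[|[|]]]]//= ?; rewrite /D/w/h/= //.
  by apply: nearW => x; rewrite mul1r.
split.
  apply: (iff_trans (BJ_orthogonal_piecewise mD tD DT fz gw)).
  rewrite !big_ord_recl big_ord0 /D/z/w/h/= sdual0 sdual1.
  have sum3 (a b c : K) :
    a * 1 * u + (b * 1 * v + (c * 0 * 1 + 0)) = a * u + b * v by ring.
  by rewrite sum3.
apply: (iff_trans (BJ_orthogonal_piecewise mD tD DT gw fz)).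
rewrite !big_ord_recl big_ord0 /D/z/w/h/=.
by rewrite 2!mulr1 mulr0 2!addr0.
Qed.

(** The integrand |f|^p is positive on the support of f, so its integral detects
    null sets. *)
Lemma mass_eq0 f D : measurable D -> D `<=` [set x | f x != 0] ->
  (mass f D == 0) = (mu D == 0%E).
Proof.
move=> mD sD; have mf := measurable_smod_powR (Lp_fun_measurable f).
apply/eqP/eqP => [m0|D0].
  apply: ae_notin_measure0 => //.
  have : (\int[mu]_(x in D) `|(smod (f x) `^ p)%:E| = 0)%E.
    rewrite -[RHS]/((0 : R)%:E) -m0 -energy_mass//; apply: eq_integral => x _.
    by rewrite gee0_abs// lee_fin powR_ge0.
  move=> /(ae_eq_integral_abs mu mD (measurable_funTS mf)).
  apply: filterS => x /= + Dx => /(_ Dx) [] /powR_eq0_eq0 /smod0_eq0 /eqP.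
  by rewrite (negbTE (sD _ Dx)).
apply: EFin_inj; rewrite -energy_mass// [RHS](_ : _ = 0%E)//.
rewrite -[RHS](integral_abs_eq0 mD (measurable_funTS mf) D0).
apply: eq_integral => x _.
by rewrite gee0_abs// lee_fin powR_ge0.
Qed.

Lemma mass_gt0 f D : measurable D -> D `<=` [set x | f x != 0] ->
  (0 < mass f D) = (0 < mu D)%E.
Proof.
by move=> mD sD; rewrite lt_def mass_eq0// mass_ge0 andbT measure_gt0.
Qed.

Lemma massU f A B : measurable A -> measurable B -> A `&` B = set0 ->
  mass f (A `|` B) = mass f A + mass f B.
Proof.
move=> mA mB AB0; have mf := measurable_smod_powR (Lp_fun_measurable f).
apply: EFin_inj; rewrite EFinD -!energy_mass//; last exact: measurableU.
rewrite /energy ge0_integral_setU//; last by apply/disj_setPS; rewrite AB0.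
- exact: measurable_funTS.
- by move=> x _; rewrite lee_fin powR_ge0.
Qed.

Lemma measurable_Lp_support f : measurable [set x | f x != 0].
Proof.
have -> : [set x | f x != 0] = (fun x => smod (f x)) @^-1` `]0, +oo[.
  by apply/seteqP; split=> x /=; rewrite in_itv/= andbT smod_gt0.
by rewrite -[X in measurable X]setTI; apply: measurable_smod => //;
  exact: Lp_fun_measurable.
Qed.

Lemma scalar_measurable_real (r : X -> R) : measurable_fun setT r ->
  @scalar_measurable R k d X (fun x => (r x)%:K).
Proof. by case: k => //= mr; split. Qed.

Section restriction.
Variables (f : Lpf) (A : set X) (mA : measurable A).

Lemma Lp_restrict_subproof :
  (fun x => (\1_A x)%:K * f x : K^o) \in Lp_integrable k mu (ltW p_gt1).
Proof.
have mf : scalar_measurable (f : X -> K) := Lp_fun_measurable f.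
have mAf : @scalar_measurable R k d X (fun x => (\1_A x)%:K * f x).
  by apply: scalar_measurableM => //; apply: scalar_measurable_real.
apply/asboolP; split=> //.
rewrite Lp_eseminorm_energy poweR_lty//.
apply: le_lt_trans (Lp_energy_lty f measurableT).
apply: ge0_le_integral => //.
- by move=> x _; rewrite lee_fin powR_ge0.
- exact: measurable_smod_powR.
- exact: measurable_smod_powR.
- move=> x _; rewrite lee_fin.
  rewrite ge0_ler_powR ?nnegrE ?smod_ge0//; first exact: ltW.
  rewrite smodM smod_real ler_piMl ?smod_ge0// indicE.
  by case: (_ \in _); rewrite ?normr1 ?normr0.
Qed.

Definition Lp_restrict : Lpf := MkLp_fun Lp_restrict_subproof.

End restriction.

End energy.
(** * Balanced functions and the classification of symmetric ones *)

Section symmetry.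
Context {R : realType} {k : scalar_kind} {d} {X : measurableType d}.
Context (mu : {measure set X -> \bar R}) {p : R} (p_gt1 : 1 < p).
Local Notation K := (scalar_field R k).
Local Notation Lpf := (Lp_fun k mu (ltW p_gt1)).
Implicit Types (f g : Lpf) (A B : set X).

(** What either symmetry yields, and all that the classification needs. *)
Definition balanced f := forall A B, measurable A -> measurable B ->
  A `&` B = set0 -> [set x | f x != 0] = A `|` B ->
  0 < mass f A -> 0 < mass f B -> mass f A = mass f B.

(** The test functions against which symmetry is exploited. *)
Lemma exists_step_multiple f A B (u v : K) : measurable A -> measurable B ->
  A `&` B = set0 -> exists g : Lpf,
    {ae mu, forall x, A x -> g x = u * f x} /\
    {ae mu, forall x, B x -> g x = v * f x}.
Proof.
move=> mA mB AB0.
have nAB x : A x -> B x -> False.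
  by move=> Ax Bx; suff : set0 x by []; rewrite -AB0.
exists (u *: Lp_restrict f mA + v *: Lp_restrict f mB).
have gE x : (u *: Lp_restrict f mA + v *: Lp_restrict f mB : Lpf) x =
  u * ((\1_A x)%:K * f x) + v * ((\1_B x)%:K * f x) by [].
split; apply: nearW => x Dx; rewrite gE !indicE.
- rewrite mem_set// memNset; last exact: nAB.
  by rewrite real_to_scalar1 real_to_scalar0; ring.
- rewrite memNset; last by move=> /nAB; exact.
  by rewrite mem_set// real_to_scalar1 real_to_scalar0; ring.
Qed.

(** The function equal to b f on A and - a f on B is a test function to which f
    is orthogonal, a and b being the masses of A and B. *)
Lemma left_symmetric_balanced f : p != 2 ->
  left_symmetric (Lp_class f) -> balanced f.
Proof.
move=> p2 fsym A B mA mB AB0 fAB; set a := mass f A; set b := mass f B => a0 b0.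
have [g [gA gB]] := exists_step_multiple f b%:K (- a%:K) mA mB AB0.
have [] := BJ_orthogonal_two_pieces mA mB AB0 fAB gA gB.
rewrite -/a -/b; clearbody a b => fg gf.
have /fsym/gf : BJ_orthogonal (Lp_class f) (Lp_class g) by apply/fg; ring.
rewrite sdualN !sdual_real// mulrN => /subr0_eq.
rewrite -!real_to_scalarM => /real_to_scalar_inj.
by apply: mul_powR_inj => //; apply: contra p2 => /eqP p2; apply/eqP; lra.
Qed.

(** The multipliers of the left case are replaced by their preimages under the
    duality map, so that now the test function is orthogonal to f. *)
Lemma right_symmetric_balanced f : p != 2 ->
  right_symmetric (Lp_class f) -> balanced f.
Proof.
move=> p2 fsym A B mA mB AB0 fAB; set a := mass f A; set b := mass f B => a0 b0.
pose s := (p - 1)^-1.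
have sp : s * (p - 1) = 1 by rewrite mulVf// gt_eqF// subr_gt0.
have sdual_pow (c : R) : 0 < c -> sdual p (c `^ s)%:K = c%:K :> K.
  by move=> c0; rewrite sdual_real ?powR_gt0// -powRrM sp powRr1// ltW.
have [g [gA gB]] :=
  exists_step_multiple f (b `^ s)%:K (- (a `^ s)%:K) mA mB AB0.
have [] := BJ_orthogonal_two_pieces mA mB AB0 fAB gA gB.
rewrite -/a -/b; clearbody a b => fg gf.
have /fsym/fg : BJ_orthogonal (Lp_class g) (Lp_class f).
  by apply/gf; rewrite sdualN !sdual_pow//; ring.
rewrite mulrN => /subr0_eq.
rewrite -!real_to_scalarM => /real_to_scalar_inj.
apply: mul_powR_inj => //; apply: contra p2 => /eqP s1; apply/eqP.
by move: sp; rewrite s1; lra.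
Qed.

(** Covers all three cases of the classification: two atoms of equal mass, or,
    with B empty, a single atom or a null support. As [sdual p] is odd and
    injective, u + v = 0 iff sdual u + sdual v = 0, and u = 0 iff sdual u = 0. *)
Lemma symmetric_two_pieces f A B : measurable A -> measurable B ->
  A `&` B = set0 -> [set x | f x != 0] = A `|` B ->
  (forall g, exists u : K, {ae mu, forall x, A x -> g x = u * f x}) ->
  (forall g, exists u : K, {ae mu, forall x, B x -> g x = u * f x}) ->
  mass f A = mass f B \/ mass f B = 0 ->
  left_symmetric (Lp_class f) /\ right_symmetric (Lp_class f).
Proof.
move=> mA mB AB0 fAB multA multB massAB.
suff BJ_sym g : BJ_orthogonal (Lp_class f) (Lp_class g) <->
                BJ_orthogonal (Lp_class g) (Lp_class f).
  by split=> y; rewrite -[y]Lp_reprK => /BJ_sym.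
have [u gA] := multA g; have [v gB] := multB g.
have [fg gf] := BJ_orthogonal_two_pieces mA mB AB0 fAB gA gB.
apply: (iff_trans fg); apply: (iff_trans _ (iff_sym gf)).
have scale0 (m : R) (z : K) : m%:K * z = 0 <-> m = 0 \/ z = 0.
  split=> [/eqP|[->|->]]; last 2 first.
  - by rewrite real_to_scalar0 mul0r.
  - by rewrite mulr0.
  rewrite mulf_eq0 -smod_eq0 smod_real normr_eq0.
  by case/orP => /eqP; [left|right].
have [->|->] := massAB.
- rewrite -!mulrDr !(scale0 (mass f B)).
  suff -> : (u + v = 0) = (sdual p u + sdual p v = 0) by exact: iff_refl.
  apply/propext; split=> [/eqP|/eqP].
    by rewrite addr_eq0 => /eqP ->; rewrite sdualN addNr.
  by rewrite addr_eq0 -sdualN => /eqP /(sdual_inj p_gt1) ->; rewrite addNr.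
- rewrite real_to_scalar0 !mul0r !addr0 !(scale0 (mass f A)).
  suff -> : (u = 0) = (sdual p u = 0) by exact: iff_refl.
  apply/propext; split=> [->|]; first exact: sdual0.
  by rewrite -[X in _ = X](sdual0 p) => /(sdual_inj p_gt1).
Qed.

Lemma ae_exists_in_atom A (P : X -> Prop) : is_atom mu A ->
  {ae mu, forall x, P x} -> exists2 x, A x & P x.
Proof.
move=> Aatom aeP; apply: contrapT => nex; apply: (atom_not_null Aatom).
by apply: filterS aeP => x Px Ax; apply: nex; exists x.
Qed.

(** Both f and g are a.e. constant on A, and the constant of f is nonzero because
    it is attained at a point of the support. *)
Lemma multiple_on_atom f A g : is_atom mu A -> A `<=` [set x | f x != 0] ->
  exists u : K, {ae mu, forall x, A x -> g x = u * f x}.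
Proof.
move=> Aatom Af.
have [c fc] := scalar_measurable_ae_cst_on_atom Aatom (Lp_fun_measurable f).
have [e ge] := scalar_measurable_ae_cst_on_atom Aatom (Lp_fun_measurable g).
have [x Ax /(_ Ax) fxc] := ae_exists_in_atom Aatom fc.
have c0 : c != 0 by rewrite -fxc; exact: Af.
exists (e / c); apply: filterS2 fc ge => y /= fy gy Ay.
by rewrite fy// gy// mulfVK.
Qed.

Lemma mass_ae_cst f A (c : K) : measurable A ->
  {ae mu, forall x, A x -> f x = c} ->
  (mu A * (smod c `^ p)%:E)%E = (mass f A)%:E.
Proof.
move=> mA fc; rewrite -energy_mass//.
transitivity (\int[mu]_(x in A) cst (smod c `^ p)%:E x)%E.
  by rewrite integral_cst// [RHS]muleC.
apply/esym; apply: ge0_ae_eq_integral => //.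
- exact/measurable_funTS/measurable_smod_powR/Lp_fun_measurable.
- by move=> x _; rewrite lee_fin powR_ge0.
- by move=> x _; rewrite lee_fin powR_ge0.
- by apply: filterS fc => x /= fx Ax; rewrite fx.
Qed.

Lemma mass_eq_ae f A B : is_atom mu A -> is_atom mu B ->
  mass f A = mass f B <->
  {ae mu, forall x, A x -> {ae mu, forall y, B y ->
    (mu A * (smod (f x) `^ p)%:E = mu B * (smod (f y) `^ p)%:E)%E}}.
Proof.
move=> Aatom Batom; have [[mA _ _] [mB _ _]] := (Aatom, Batom).
have [a fa] := scalar_measurable_ae_cst_on_atom Aatom (Lp_fun_measurable f).
have [b fb] := scalar_measurable_ae_cst_on_atom Batom (Lp_fun_measurable f).
have [mass_a mass_b] := (mass_ae_cst mA fa, mass_ae_cst mB fb).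
split=> [eqm|aeAB].
  apply: filterS fa => x fx Ax; apply: filterS fb => y fy By.
  by rewrite (fx Ax) (fy By) mass_a mass_b eqm.
have [x Ax [/(_ Ax) fx /(_ Ax) aeB]] :=
  ae_exists_in_atom Aatom (filterI fa aeAB).
have [y By [/(_ By) fy /(_ By)]] :=
  ae_exists_in_atom Batom (filterI fb aeB).
by rewrite fx fy mass_a mass_b => -[].
Qed.

(** If A could be cut into positive parts C and D, balance applied to the splits
    C, D + B and D, C + B would make the masses satisfy c = d + b and d = c + b,
    forcing b = 0. *)
Lemma balanced_piece_atom f A B : balanced f ->
  measurable A -> measurable B -> A `&` B = set0 ->
  [set x | f x != 0] = A `|` B -> (0 < mu A)%E -> (0 < mu B)%E -> is_atom mu A.
Proof.
move=> bal mA mB AB0 fAB A0 B0; split=> // C mC CA C0.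
apply/eqP/negPn/negP; rewrite -measure_gt0 => D0.
have mD : measurable (A `\` C) by exact: measurableD.
set D := A `\` C in mD D0 *.
have nAB x : A x -> B x -> False.
  by move=> Ax Bx; suff : set0 x by []; rewrite -AB0.
have AE : A = C `|` D by rewrite /D setDUK.
have DA : D `<=` A by exact: subDsetl.
have CD0 : C `&` D = set0 by rewrite -subset0 => x [Cx [_ /(_ Cx)]].
have DB0 : D `&` B = set0 by rewrite -subset0 => x [/DA Ax] /(nAB _ Ax).
have CB0 : C `&` B = set0 by rewrite -subset0 => x [/CA Ax] /(nAB _ Ax).
have sA : A `<=` [set x | f x != 0] by rewrite fAB; exact: subsetUl.
have sB : B `<=` [set x | f x != 0] by rewrite fAB; exact: subsetUr.
have fC : [set x | f x != 0] = C `|` (D `|` B) by rewrite fAB AE setUA.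
have fD : [set x | f x != 0] = D `|` (C `|` B) by rewrite fAB AE setUCA setUA.
have := bal C (D `|` B) mC (measurableU _ _ mD mB).
have := bal D (C `|` B) mD (measurableU _ _ mC mB).
rewrite !setIUr CD0 CB0 DB0 [D `&` C]setIC CD0 !setU0.
rewrite (massU f mD mB DB0) (massU f mC mB CB0).
have C1 : 0 < mass f C by rewrite mass_gt0//; exact: subset_trans sA.
have D1 : 0 < mass f D by rewrite mass_gt0//; exact: subset_trans sA.
have B1 : 0 < mass f B by rewrite mass_gt0.
move=> /(_ erefl fD D1 (addr_gt0 C1 B1)) e1.
move=> /(_ erefl fC C1 (addr_gt0 D1 B1)) e2.
by move: B1 e1 e2; clear; lra.
Qed.

Lemma balanced_classification f : balanced f ->
  [\/ {ae mu, forall x, f x = 0}, is_atom mu [set x | f x != 0] |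
    exists A B : set X,
      [/\ is_atom mu A, is_atom mu B, [set x | f x != 0] = A `|` B,
          A `&` B = set0 & mass f A = mass f B]].
Proof.
move=> bal; set S := [set x | f x != 0].
have mS : measurable S := measurable_Lp_support f.
have [S0|] := eqVneq (mu S) 0%E.
  constructor 1; apply: filterS (ae_notin mS S0) => x /=.
  by move=> /negP/negPn/eqP.
rewrite -measure_gt0 => S0.
have [Satom|Snatom] := pselect (is_atom mu S); first by constructor 2.
(* B witnesses that S is not an atom; S \ B is the other piece. *)
have [B [mB BS B0 SB0]] : exists B, [/\ measurable B, B `<=` S,
    (0 < mu B)%E & (0 < mu (S `\` B))%E].
  apply: contrapT => nex; apply: Snatom; split=> // B mB BS B0.
  apply/eqP/negPn/negP; rewrite -measure_gt0 => SB0.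
  by apply: nex; exists B.
have mA : measurable (S `\` B) by exact: measurableD.
have AB0 : (S `\` B) `&` B = set0 by rewrite -subset0 => x [[_ nBx] /nBx].
have SAB : S = (S `\` B) `|` B by rewrite setDKU.
have BA0 : B `&` (S `\` B) = set0 by rewrite setIC.
have SBA : S = B `|` (S `\` B) by rewrite setUC.
constructor 3; exists (S `\` B), B; split=> //.
- exact: balanced_piece_atom SAB _ _.
- exact: balanced_piece_atom SBA _ _.
- by apply: bal => //; rewrite mass_gt0//; exact: subDsetl.
Qed.

(** An atom is not null, and an atom that contains A and B disjointly cannot give
    both of them positive measure; the extra requirement [Q] is carried
    along. *)
Lemma null_or_atom_or_two_atoms_exclusive f (Q : set X -> set X -> Prop) :
  let two_atoms := exists A B : set X,
    [/\ is_atom mu A, is_atom mu B, [set x | f x != 0] = A `|` B,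
        A `&` B = set0 & Q A B] in
  [\/ {ae mu, forall x, f x = 0}, is_atom mu [set x | f x != 0] | two_atoms] ->
  exactly_one {ae mu, forall x, f x = 0} (is_atom mu [set x | f x != 0])
    two_atoms.
Proof.
move=> two_atoms.
have null_atom A : A `<=` [set x | f x != 0] ->
    is_atom mu A -> ~ {ae mu, forall x, f x = 0}.
  move=> Af /ae_exists_in_atom Aex /Aex [x /Af /= + fx0].
  by rewrite fx0 eqxx.
have null_two : two_atoms -> ~ {ae mu, forall x, f x = 0}.
  move=> [A [B [Aatom _ fAB _ _]]]; apply: null_atom Aatom.
  by rewrite fAB; exact: subsetUl.
have atom_two : two_atoms -> ~ is_atom mu [set x | f x != 0].
  move=> [A [B [[mA A0 _] [mB B0 _] fAB AB0 _]]] [_ _].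
  rewrite fAB => /(_ A mA (@subsetUl _ _ _) A0).
  rewrite setDUl setDv set0U setDidl; last by rewrite setIC.
  by move=> B00; rewrite B00 ltxx in B0.
case=> [f0|fatom|ftwo].
- constructor 1; split=> // [/(null_atom _ (@subset_refl _ _))|/null_two]; exact.
- by constructor 2; split=> // [/(null_atom _ (@subset_refl _ _) fatom)|/atom_two].
- by constructor 3; split=> // [/(null_two ftwo)|/(atom_two ftwo)].
Qed.

End symmetry.

Theorem theorem4p0p3 (R : realType) (k : scalar_kind)
    (d : measure_display) (X : measurableType d)
    (lambda : {measure set X -> \bar R})
    (p : R) (p_gt1 : 1 < p) (p_neq2 : p != 2)
    (f : Lp_fun k lambda (ltW p_gt1)) :
  [<-> left_symmetric (Lp_class f);
       right_symmetric (Lp_class f);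
       exactly_one
         {ae lambda, forall x, f x = 0}
         (is_atom lambda [set x | f x != 0])
         (exists A B : set X,
           [/\ is_atom lambda A, is_atom lambda B,
               [set x | f x != 0] = A `|` B, A `&` B = set0 &
               {ae lambda, forall x, A x -> {ae lambda, forall y, B y ->
                 (lambda A * (smod (f x) `^ p)%:E
                  = lambda B * (smod (f y) `^ p)%:E)%E}}])].
Proof.
set cond := exactly_one _ _ _.
have of_balanced : balanced f -> cond.
  move=> bal; apply: null_or_atom_or_two_atoms_exclusive.
  have [f0|fatom|] := balanced_classification bal;
    [by constructor 1|by constructor 2|].
  move=> [A [B [Aatom Batom fAB AB0 mAB]]]; constructor 3; exists A, B.
  split=> //.
  by apply/(mass_eq_ae f Aatom Batom).
have symmetric :
    cond -> left_symmetric (Lp_class f) /\ right_symmetric (Lp_class f).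
  have mS := measurable_Lp_support f.
  have S0 : [set x | f x != 0] = [set x | f x != 0] `|` set0 by rewrite setU0.
  have mult0 (g : Lp_fun k lambda (ltW p_gt1)) : exists u : scalar_field R k,
      {ae lambda, forall x, (set0 : set X) x -> g x = u * f x}.
    by exists 0; apply: nearW.
  have mass0 : mass f set0 = 0 by rewrite /mass /energy integral_set0.
  case=> [[f0 _ _]|[_ fatom _]|[_ _ [A [B [Aatom Batom fAB AB0 fm]]]]].
  - apply: (symmetric_two_pieces mS measurable0 (setI0 _) S0) => //; last by right.
    by move=> g; exists 0; apply: filterS f0 => x fx /=; rewrite fx eqxx.
  - apply: (symmetric_two_pieces mS measurable0 (setI0 _) S0) => //; last by right.
    by move=> g; exact: multiple_on_atom fatom _.
  - have [[mA _ _] [mB _ _]] := (Aatom, Batom).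
    apply: (symmetric_two_pieces mA mB AB0 fAB); last first.
    + by left; apply/(mass_eq_ae f Aatom Batom).
    + by move=> g; apply: multiple_on_atom Batom _; rewrite fAB; exact: subsetUr.
    + by move=> g; apply: multiple_on_atom Aatom _; rewrite fAB; exact: subsetUl.
tfae.
- by move=> /(left_symmetric_balanced p_neq2)/of_balanced/symmetric[].
- by move=> /(right_symmetric_balanced p_neq2)/of_balanced.
- by move=> /symmetric[].
Qed.
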